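(* Let $(\mathcal X,\psi)$ be a Polish metric space, $V:\mathcal X\to[0,\infty)$ continuous, $\alpha\in(0,1)$ and $A>0$. Define $$c_{\alpha,A}(x,y):=\psi(x,y)^\alpha\{A+V(x)+V(y)\}^{1-\alpha},\qquad d_{\alpha,A}(x,y):=\inf_{m\ge1}\ \inf_{x=z_0,\ldots,z_m=y}\ \sum_{i=1}^mc_{\alpha,A}(z_{i-1},z_i),$$ where the inner infimum is over all finite sequences $z_0,\dots,z_m$ in $\mathcal X$ from $x$ to $y$. Then for every $x,y\in\mathcal X$, $$A^{1-\alpha}\psi(x,y)^\alpha\le d_{\alpha,A}(x,y)\le c_{\alpha,A}(x,y).$$ Consequently, $d_{\alpha,A}$ is a Polish metric on $\mathcal X$ (i.e. a complete separable metric) that generates the same topology and Borel $\sigma$-field as $\psi$. Moreover, $$\{g:\mathcal X\to\mathbb R:\ |g(x)-g(y)|\le c_{\alpha,A}(x,y)\ \text{for all }x,y\in\mathcal X\}=\{g:\mathcal X\to\mathbb R:\ \operatorname{Lip}_{d_{\alpha,A}}(g)\le1\}.$$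
   Context: Polish metric space: complete separable metric space. For a metric $d$ and a real-valued function $g$, $\operatorname{Lip}_d(g)=\sup_{x\ne y}|g(x)-g(y)|/d(x,y)$. *)

(* Defs.v *)
(* MathComp / MathComp-Analysis *)
From HB Require Import structures.
From mathcomp Require Import all_boot all_order all_algebra.
From mathcomp Require Import all_classical all_reals all_analysis.

Set Implicit Arguments.
Unset Strict Implicit.
Unset Printing Implicit Defensive.

Import Order.TTheory GRing.Theory Num.Theory.
Import numFieldNormedType.Exports.

Local Open Scope classical_set_scope.
Local Open Scope ring_scope.

Record is_metric (R : realType) (X : Type) (d : X -> X -> R) : Prop := IsMetric {
  is_metric_ge0 : forall x y, 0 <= d x y;
  is_metric_eq0 : forall x y, d x y = 0 <-> x = y;
  is_metric_sym : forall x y, d x y = d y x;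
  is_metric_triangle : forall x y z, d x z <= d x y + d y z }.

(* The set X with the metric, uniformity and topology induced by d; an alias
   is needed because X may already carry another topology. *)
Definition metrized (R : realType) (X : choiceType) (d : X -> X -> R)
  (dM : is_metric d) : Type := X.

Section metrized.
Variables (R : realType) (X : choiceType) (d : X -> X -> R).
Variable dM : is_metric d.

Let dxx (x : metrized dM) : d x x = 0.
Proof. exact/(is_metric_eq0 dM). Qed.

Let d_eq0 (x y : metrized dM) : d x y = 0 -> x = y.
Proof. by move/(is_metric_eq0 dM). Qed.

Let d_sym (x y : metrized dM) : d x y = d y x.
Proof. exact: is_metric_sym dM x y. Qed.

Let d_triangle (y x z : metrized dM) : d x z <= d x y + d y z.
Proof. exact: is_metric_triangle dM x y z. Qed.

HB.instance Definition _ := Choice.copy (metrized dM) X.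
HB.instance Definition _ :=
  isMetric.Build R (metrized dM) dxx d_eq0 d_sym d_triangle.

End metrized.

(* The first conjunct is the axiom of the structure Complete, which is not used
   itself because it requires a distinguished point. *)
Definition polish_metric (R : realType) (T : metricType R) : Prop :=
  (forall F : set_system T, ProperFilter F -> cauchy F -> exists l : T, F --> l)
  /\ exists D : set T, countable D /\ dense D.

Definition borel (T : topologicalType) : set (set T) := <<s @open T >>.
Arguments borel T : clear implicits.

Definition cost (R : realType) (X : metricType R) (V : X -> R) (alpha A : R)
    (x y : X) : R :=
  mdist x y `^ alpha * (A + V x + V y) `^ (1 - alpha).

(* A chain z_0, ..., z_m is encoded by a function on nat, whose values beyond m
   play no role. *)
Definition chain_inf (R : realType) (X : Type) (c : X -> X -> R) (m : nat)
    (x y : X) : R :=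
  inf [set \sum_(i < m) c (z i) (z i.+1)
      | z in [set z : nat -> X | z 0%N = x /\ z m = y]].

Definition chain_dist (R : realType) (X : Type) (c : X -> X -> R)
    (x y : X) : R :=
  inf [set chain_inf c m x y | m in [set m : nat | (1 <= m)%N]].

(* Extended-real valued; on a space with at most one point the supremum is over
   the empty set and equals -oo. *)
Definition Lip (R : realType) (X : Type) (d : X -> X -> R) (g : X -> R) :
    \bar R :=
  ereal_sup [set (`|g p.1 - g p.2| / d p.1 p.2)%:E
            | p in [set p : X * X | p.1 <> p.2]].

(* Main.v *)
(** The function [chain_dist c] is the largest function below the cost [c] that
satisfies the triangle inequality. Since [t `^ alpha] is subadditive,
[A `^ (1 - alpha) * psi `^ alpha] satisfies the triangle inequality, and it is
below [c]: this gives the lower bound, whence Cauchy filters and convergence for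
[d] are controlled by those for [psi]. Conversely [c x y] tends to 0 as [y]
tends to [x], because [V] is locally bounded, so both metrics induce the same
topology. The last claim is maximality applied to [`|g x - g y|]. *)
Require Import Defs.
From mathcomp Require Import all_boot all_order all_algebra.
From mathcomp Require Import all_classical all_reals all_analysis.
From mathcomp Require Import lra.

Set Implicit Arguments.
Unset Strict Implicit.
Unset Printing Implicit Defensive.

Import Order.TTheory GRing.Theory Num.Theory.
Import numFieldNormedType.Exports.
Local Open Scope classical_set_scope.
Local Open Scope ring_scope.

(** Each [s] in [[0, 1]] satisfies [s <= s]^ r[, as]r <= 1[. Take for]s[the fractions]a / (a +
    b)[and]b / (a + b)[, whose sum is 1, and multiply by](a + b) [^ r]. *)
Lemma powR_subadditive (R : realType) (r a b : R) :
  0 <= r <= 1 -> 0 <= a -> 0 <= b -> (a + b) `^ r <= a `^ r + b `^ r.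
Proof.
move=> /andP[r0 r1] a0 b0.
have [ab0|ab0] := eqVneq (a + b) 0.
  have -> : a = 0 by lra.
  by rewrite add0r lerDr powR_ge0.
have s0 : 0 < a + b by rewrite lt_neqAle eq_sym ab0 addr_ge0.
have frac (t : R) : 0 <= t -> t <= a + b ->
    t / (a + b) * (a + b) `^ r <= t `^ r.
  move=> t0 ts; rewrite -{2}(divfK ab0 t) powRM ?divr_ge0 ?(ltW s0)//.
  apply: ler_wpM2r; first exact: powR_ge0.
  have [->|tN0] := eqVneq t 0; first by rewrite mul0r powR_ge0.
  have t_gt0 : 0 < t by rewrite lt_neqAle eq_sym tN0.
  by apply: ger1_powR => //; rewrite divr_gt0//= ler_pdivrMr// mul1r.
rewrite -[leLHS]mul1r -(divff ab0) mulrDl mulrDl.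
by apply: lerD; apply: frac => //; lra.
Qed.

(** * Infimum over chains of a general cost *)

Section chain_dist.
Variables (R : realType) (X : Type) (c : X -> X -> R).

Lemma lb_chain_dist (b : R) (x y : X) :
  (forall m (z : nat -> X), z 0%N = x -> z m.+1 = y ->
     b <= \sum_(i < m.+1) c (z i) (z i.+1)) ->
  b <= chain_dist c x y.
Proof.
move=> hb; apply: lb_le_inf; first by exists (chain_inf c 1 x y), 1%N.
move=> _ [[//|m] _ <-]; apply: lb_le_inf.
  (* The chain [x, y, ..., y] shows that the set under the infimum is inhabited for every positive
     length. *)
  pose z i := if i is 0%N then x else y.
  by exists (\sum_(i < m.+1) c (z i) (z i.+1)), z.
by move=> _ [z [z0 zm] <-]; exact: hb.
Qed.

(** Maximality: by induction on the length, the triangle inequality bounds [p] between the ends of a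
    chain by the cost of the chain. *)
Lemma le_chain_dist (p : X -> X -> R) :
  (forall x y z, p x z <= p x y + p y z) -> (forall x y, p x y <= c x y) ->
  forall x y, p x y <= chain_dist c x y.
Proof.
move=> ptri pc x y; apply: lb_chain_dist => m z <- <-.
elim: m => [|m IH]; first by rewrite big_ord_recr big_ord0 /= add0r.
by rewrite big_ord_recr /= (le_trans (ptri _ (z m.+1) _))// lerD.
Qed.

Hypothesis c_ge0 : forall x y, 0 <= c x y.

Lemma chain_dist_le_sum (z : nat -> X) (m : nat) :
  chain_dist c (z 0%N) (z m.+1) <= \sum_(i < m.+1) c (z i) (z i.+1).
Proof.
(* This makes the outer set bounded below, as [ge_inf] demands. If no chain exists, the infimum is
   that of the empty set, which is 0 by convention. *)
have inf_ge0 n x y : 0 <= chain_inf c n x y.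
  have [[e Ee]|/nonemptyPn E0] := pselect ([set \sum_(i < n) c (z i) (z i.+1)
      | z in [set z : nat -> X | z 0%N = x /\ z n = y]] !=set0).
    apply: lb_le_inf; first by exists e.
    by move=> _ [w _ <-]; exact: sumr_ge0.
  by rewrite /chain_inf E0 inf0.
apply: (@le_trans _ _ (chain_inf c m.+1 (z 0%N) (z m.+1))).
  apply: ge_inf; last by exists m.+1.
  by exists 0 => _ [n _ <-].
apply: ge_inf; last by exists z.
by exists 0 => _ [w _ <-]; exact: sumr_ge0.
Qed.

Lemma chain_dist_le (x y : X) : chain_dist c x y <= c x y.
Proof.
have := chain_dist_le_sum (fun i => if i is 0%N then x else y) 0.
by rewrite big_ord_recl big_ord0 addr0.
Qed.

Lemma chain_dist_ge0 (x y : X) : 0 <= chain_dist c x y.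
Proof. by apply: (le_chain_dist (p := fun=> fun=> 0)) => // *; rewrite addr0. Qed.

(** Prepending [x] to a chain from [y] to [z] gives a chain from [x] to [z]. *)
Lemma chain_dist_cons (x y z : X) :
  chain_dist c x z <= c x y + chain_dist c y z.
Proof.
rewrite -lerBlDl; apply: lb_chain_dist => m w w0 wm.
have := chain_dist_le_sum (fun i => if i is j.+1 then w j else x) m.+1.
by rewrite big_ord_recl /= w0 wm lerBlDl.
Qed.

(** Maximality replaces the concatenation of chains: for fixed [z], the difference of the distances
    of [u] and [v] to [z] satisfies the triangle inequality with equality, and is below [c u v] by
    [chain_dist_cons]. *)
Lemma chain_dist_triangle (x y z : X) :
  chain_dist c x z <= chain_dist c x y + chain_dist c y z.
Proof.
rewrite -lerBlDr.
apply: (le_chain_dist (p := fun u v => chain_dist c u z - chain_dist c v z)).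
  by move=> u v w; rewrite addrA subrK.
by move=> u v; rewrite lerBlDr chain_dist_cons.
Qed.

Lemma chain_dist_sym : (forall x y, c x y = c y x) ->
  forall x y, chain_dist c x y = chain_dist c y x.
Proof.
move=> csym.
suff le x y : chain_dist c y x <= chain_dist c x y.
  by move=> x y; apply/eqP; rewrite eq_le !le.
apply: (le_chain_dist (p := fun u v => chain_dist c v u)) => [u v w|u v].
  by rewrite addrC chain_dist_triangle.
by rewrite csym chain_dist_le.
Qed.

End chain_dist.

(** * Comparison of two metrics on one set *)

Lemma cauchy_metrized_cvg (R : realType) (X : metricType R) (d : X -> X -> R)
    (dM : is_metric d) (F : set_system X) :
  (forall e : R, 0 < e ->
    exists2 r : R, 0 < r & forall x y : X, d x y < r -> mdist x y < e) ->
  ProperFilter F -> @cauchy (metrized dM) F -> @cauchy X F.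
Proof.
move=> dX PF /cauchyP Fc; apply/cauchyP => e e0.
have [r r0 dr] := dX _ e0; have [x Fx] := Fc r r0.
by exists x; apply: filterS Fx => y; rewrite !ballEmdist; exact: dr.
Qed.

Section metrized_topology.
Variables (R : realType) (X : metricType R) (d : X -> X -> R).
Variable dM : is_metric d.
(** Uniform in both points, so that Cauchy filters for [d] are Cauchy for [mdist]. In [d_small] the
    radius may depend on [x], which suffices for neighbourhoods and allows an unbounded [V]. *)
Hypothesis mdist_small : forall e : R, 0 < e ->
  exists2 r : R, 0 < r & forall x y : X, d x y < r -> mdist x y < e.
Hypothesis d_small : forall (x : X) (e : R), 0 < e ->
  exists2 r : R, 0 < r & forall y : X, mdist x y < r -> d x y < e.

Lemma nbhs_metrized (x : X) : @nbhs _ (metrized dM) x = @nbhs _ X x.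
Proof.
apply/seteqP; split=> P /nbhs_ballP[e /= e0 xeP]; apply/nbhs_ballP.
  have [r r0 rP] := d_small x e0; exists r => // y xy; apply: xeP.
  by move: xy; rewrite !ballEmdist; exact: rP.
have [r r0 rP] := mdist_small e0; exists r => // y xy; apply: xeP.
by move: xy; rewrite !ballEmdist; exact: rP.
Qed.

Lemma open_metrized (U : set X) : @open (metrized dM) U <-> @open X U.
Proof.
rewrite !openE /interior /=; split=> UU x Ux; have := UU x Ux;
  by rewrite nbhs_metrized.
Qed.

Lemma polish_metrized : polish_metric X -> polish_metric (metrized dM).
Proof.
move=> [complete [D [cD dD]]]; split=> [F PF Fc|].
  have [l Fl] := complete F PF (cauchy_metrized_cvg mdist_small PF Fc).
  by exists l => P; rewrite nbhs_metrized; exact: Fl.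
by exists D; split=> // O O0 /open_metrized; exact: dD.
Qed.

Lemma borel_metrized : borel (metrized dM) = borel X.
Proof.
rewrite /borel; congr (<<s _ >>).
by apply/seteqP; split=> U /open_metrized.
Qed.

End metrized_topology.

(** * The cost built from [V], [alpha] and [A] *)

Section cost.
Variables (R : realType) (X : metricType R) (V : X -> R) (alpha A : R).
Hypotheses (V_ge0 : forall x, 0 <= V x) (alpha_gt0 : 0 < alpha)
  (alpha_lt1 : alpha < 1) (A_gt0 : 0 < A).
Let c := cost V alpha A.

Lemma cost_ge0 (x y : X) : 0 <= c x y.
Proof. by rewrite mulr_ge0 ?powR_ge0. Qed.

Lemma costxx (x : X) : c x x = 0.
Proof. by rewrite /c /cost mdistxx powR0 ?gt_eqF// mul0r. Qed.

Lemma cost_sym (x y : X) : c x y = c y x.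
Proof. by rewrite /c /cost metric_sym addrAC. Qed.

Lemma cost_lb (x y : X) : A `^ (1 - alpha) * mdist x y `^ alpha <= c x y.
Proof.
rewrite mulrC ler_wpM2l ?powR_ge0// ge0_ler_powR ?nnegrE ?subr_ge0 ?(ltW alpha_lt1)//.
- exact: ltW.
- by rewrite !addr_ge0// ltW.
- by rewrite -addrA lerDl addr_ge0.
Qed.

Lemma chain_cost_lb (x y : X) :
  A `^ (1 - alpha) * mdist x y `^ alpha <= chain_dist c x y.
Proof.
apply: (le_chain_dist (p := fun x y => A `^ (1 - alpha) * mdist x y `^ alpha)).
  move=> u v w; rewrite -mulrDr ler_wpM2l ?powR_ge0//.
  apply: (@le_trans _ _ ((mdist u v + mdist v w) `^ alpha)).
    by rewrite ge0_ler_powR ?nnegrE ?addr_ge0 ?mdist_ge0 ?metric_triangle// ltW.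
  by apply: powR_subadditive; rewrite ?mdist_ge0 ?ltW.
exact: cost_lb.
Qed.

Lemma is_metric_chain_cost : is_metric (chain_dist c).
Proof.
split=> [x y|x y|x y|x y z].
- exact: chain_dist_ge0 cost_ge0 x y.
- split=> [d0|<-]; last first.
    apply/eqP; rewrite eq_le chain_dist_ge0 ?andbT; last exact: cost_ge0.
    by rewrite -(costxx x) chain_dist_le//; exact: cost_ge0.
  (* The lower bound has a positive factor [A]^ (1 - alpha)[, so a zero chain distance forces]mdist
     x y [^ alpha] to vanish. *)
  apply: mdist_positivity; apply/eqP; have := chain_cost_lb x y.
  rewrite d0 pmulr_rle0 ?powR_gt0// => h.
  have /eqP : mdist x y `^ alpha = 0 by apply/eqP; rewrite eq_le h powR_ge0.
  by rewrite powR_eq0 => /andP[].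
- exact: chain_dist_sym cost_ge0 cost_sym x y.
- exact: chain_dist_triangle cost_ge0 x y z.
Qed.

Lemma mdist_lt_chain_cost (e : R) : 0 < e ->
  exists2 r : R, 0 < r & forall x y : X, chain_dist c x y < r -> mdist x y < e.
Proof.
(* The radius is the lower bound of [chain_cost_lb] evaluated at distance [e]. *)
move=> e0; exists (A `^ (1 - alpha) * e `^ alpha).
  by rewrite mulr_gt0 ?powR_gt0.
move=> x y /(le_lt_trans (chain_cost_lb x y)).
rewrite ltr_pM2l ?powR_gt0//; apply: contraTT; rewrite -!leNgt => exy.
by rewrite ge0_ler_powR ?nnegrE ?mdist_ge0// ltW.
Qed.

Lemma cost_lt (x : X) (e : R) : continuous V -> 0 < e ->
  exists2 r : R, 0 < r & forall y : X, mdist x y < r -> c x y < e.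
Proof.
move=> V_cont e0.
(* [K] bounds the second factor of [c x y] as soon as [V y <= V x + 1]. *)
pose K := (A + V x + (V x + 1)) `^ (1 - alpha).
have K0 : 0 < K by apply: powR_gt0; have := V_ge0 x; have := A_gt0; lra.
have /nbhs_ballP[r1 /= r10 Vr1] : \forall y \near x, `|V x - V y| < 1.
  exact: (cvgr_dist_lt _ _ (V_cont x)).
pose r2 := (e / K) `^ alpha^-1.
have eK0 : 0 < e / K by rewrite divr_gt0.
exists (Num.min r1 r2); first by rewrite lt_min r10 powR_gt0.
move=> y; rewrite lt_min => /andP[xy1 xy2].
have Vy : V y <= V x + 1.
  have := Vr1 y; rewrite ballEmdist /= => /(_ xy1).
  by rewrite ltr_distl => /andP[]; lra.
apply: (@le_lt_trans _ _ (mdist x y `^ alpha * K)).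
  rewrite ler_wpM2l ?powR_ge0// ge0_ler_powR ?nnegrE ?subr_ge0 ?(ltW alpha_lt1)//.
  - by rewrite !addr_ge0// ltW.
  - by rewrite !addr_ge0// ltW.
  - by rewrite lerD2l.
rewrite -ltr_pdivlMr// -(powRr1 (ltW eK0)) -(mulVf (lt0r_neq0 alpha_gt0)) powRrM.
by rewrite gt0_ltr_powR ?nnegrE ?mdist_ge0 ?powR_ge0.
Qed.

End cost.

(** Off the diagonal [d x y] is positive and the quotient can be cleared; on the diagonal the
    inequality reads [0 <= d x x]. *)
Lemma Lip_le1P (R : realType) (X : Type) (d : X -> X -> R) (g : X -> R) :
  is_metric d ->
  (Lip d g <= 1)%E <-> forall x y, `|g x - g y| <= d x y.
Proof.
move=> dM; split=> [Lg x y|gd].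
  have [<-|xy] := pselect (x = y).
    by rewrite subrr normr0 (is_metric_ge0 dM).
  have d0 : 0 < d x y.
    rewrite lt_neqAle (is_metric_ge0 dM) andbT eq_sym.
    by apply/eqP => /(is_metric_eq0 dM).
  rewrite -[leRHS]mul1r -ler_pdivrMr// -lee_fin; apply: le_trans Lg.
  by apply: ereal_sup_ubound; exists (x, y).
apply: ge_ereal_sup => _ [[x y] /= xy <-]; rewrite lee_fin.
have d0 : 0 < d x y.
  rewrite lt_neqAle (is_metric_ge0 dM) andbT eq_sym.
  by apply/eqP => /(is_metric_eq0 dM).
by rewrite ler_pdivrMr// mul1r.
Qed.

Theorem proposition2 (R : realType) (X : metricType R) (V : X -> R)
    (alpha A : R) (hX : polish_metric X)
    (V_ge0 : forall x, 0 <= V x) (V_cont : continuous V)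
    (alpha_gt0 : 0 < alpha) (alpha_lt1 : alpha < 1) (A_gt0 : 0 < A) :
  let c := cost V alpha A in
  let d := chain_dist c in
  [/\ forall x y : X,
        A `^ (1 - alpha) * mdist x y `^ alpha <= d x y /\ d x y <= c x y,
      exists dM : is_metric d,
        [/\ polish_metric (metrized dM),
            forall U : set X, @open (metrized dM) U <-> @open X U
          & borel (metrized dM) = borel X]
    & [set g : X -> R | forall x y, `|g x - g y| <= c x y] =
      [set g : X -> R | (Lip d g <= 1)%E]].
Proof.
move=> c d.
have d_le x y : d x y <= c x y by apply: chain_dist_le; exact: cost_ge0.
have dM : is_metric d by exact: is_metric_chain_cost.
have mdist_small := mdist_lt_chain_cost V_ge0 alpha_gt0 alpha_lt1 A_gt0.
have d_small (x : X) (e : R) : 0 < e ->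
    exists2 r : R, 0 < r & forall y : X, mdist x y < r -> d x y < e.
  move=> e0.
  have [r r0 rP] := cost_lt V_ge0 alpha_gt0 alpha_lt1 A_gt0 x V_cont e0.
  (* Smallness of [c x y] near [x] passes to [d x y] because [d <= c]. *)
  by exists r => // y /rP; exact: le_lt_trans.
split.
- by move=> x y; split; [exact: chain_cost_lb|exact: d_le].
- exists dM; split.
  + exact: polish_metrized.
  + exact: open_metrized.
  + exact: borel_metrized.
- apply/seteqP; split=> g /= gc.
    apply/(Lip_le1P g dM); apply: (le_chain_dist (p := fun x y => `|g x - g y|)) => //.
    by move=> x y z; exact: ler_distD.
  by move=> x y; apply: le_trans (d_le x y); exact: (Lip_le1P g dM).1.
Qed.
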